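(* Let $\mathcal{G}$ be a magmoidal category, $\mathcal{H}$ a monoidal (semigroupal) category with associativity constraint $\psi$, and $F:\mathcal{G}\to\mathcal{H}$ a quasi-monoidal functor with structure isomorphisms $F_{X,Y}$. Let $c_{X,Y}:X\otimes Y\to X\otimes Y$ be a natural collection of isomorphisms ($X,Y\in\mathcal{G}$), defining a semigroupal functor $\mathcal{N}_l(c):\mathcal{N}_l(\mathcal{G})\to\mathcal{N}_l(\mathcal{G})$, and let $F^c$ denote the functor $F$ with the quasi-monoidal structure $F^c_{X,Y}=F_{X,Y}\circ F(c_{X,Y})$. Then the semigroupal functor $\mathcal{N}_l(c)$ defines an equivalence between the semigroupal subcategories $\mathcal{N}_l(F)$ and $\mathcal{N}_l(F^c)$ of $\mathcal{N}_l(\mathcal{G})$.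
   Context: A magmoidal category is a category $\mathcal{G}$ with a functor $\otimes:\mathcal{G}\times\mathcal{G}\to\mathcal{G}$, with no associativity or unit condition. A semigroupal category is a magmoidal category with a natural associativity isomorphism $\phi_{X,Y,Z}:X\otimes(Y\otimes Z)\to(X\otimes Y)\otimes Z$ satisfying the pentagon axiom. A semigroupal functor $F:(\mathcal{C},\phi)\to(\mathcal{D},\psi)$ is a functor with natural isomorphisms $F_{X,Y}:F(X\otimes Y)\to F(X)\otimes F(Y)$ satisfying $\psi_{F(X),F(Y),F(Z)}\circ(F(X)\otimes F_{Y,Z})\circ F_{X,Y\otimes Z}=(F_{X,Y}\otimes F(Z))\circ F_{X\otimes Y,Z}\circ F(\phi_{X,Y,Z})$; it is strict if the $F_{X,Y}$ are identities. An object's name also denotes its identity morphism. The left nucleus $\mathcal{N}_l(\mathcal{G})$ has as objects pairs $(A,a)$, with $A\in\mathcal{G}$ and $a$ a family of isomorphisms $a_{X,Y}:A\otimes(X\otimes Y)\to(A\otimes X)\otimes Y$ natural in $X,Y$. A morphism $(A,a)\to(B,b)$ is a morphism $f:A\to B$ of $\mathcal{G}$ such that $((f\otimes X)\otimes Y)\circ a_{X,Y}=b_{X,Y}\circ(f\otimes(X\otimes Y))$ for all $X,Y$. It is semigroupal with $(A,a)\otimes(B,b)=(A\otimes B,a|b)$, where $(a|b)_{X,Y}\circ a_{B,X\otimes Y}=(a_{B,X}\otimes Y)\circ a_{B\otimes X,Y}\circ(A\otimes b_{X,Y})$, with the tensor product of morphisms taken in $\mathcal{G}$, and with associativity constraint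 $\phi_{(A,a),(B,b),(C,c)}=a_{B,C}$. $\mathcal{N}_l(c)$ sends $(A,a)$ to $(A,a^c)$, where $a^c_{X,Y}\circ(A\otimes c_{X,Y})\circ c_{A,X\otimes Y}=(c_{A,X}\otimes Y)\circ c_{A\otimes X,Y}\circ a_{X,Y}$, and is the identity on underlying morphisms; it is regarded as a strict semigroupal functor. A quasi-monoidal functor $F:\mathcal{G}\to\mathcal{H}$ is a functor equipped with a natural collection of isomorphisms $F_{X,Y}:F(X\otimes Y)\to F(X)\otimes F(Y)$ (no coherence required). $\mathcal{N}_l(F)$ is the full subcategory of $\mathcal{N}_l(\mathcal{G})$ (closed under tensor product) of pairs $(A,a)$ such that for all $X,Y\in\mathcal{G}$ $$\psi_{F(A),F(X),F(Y)}\circ(F(A)\otimes F_{X,Y})\circ F_{A,X\otimes Y}=(F_{A,X}\otimes F(Y))\circ F_{A\otimes X,Y}\circ F(a_{X,Y}),$$ and $\mathcal{N}_l(F^c)$ is defined in the same way using $F^c_{X,Y}$ in place of $F_{X,Y}$.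
   Formalization: N_l(c) is in general not strict, as identities need not be coherent; it is given the structure isomorphisms c_{A,B}, and the strict case is covered whenever identities do form a semigroupal structure. The equivalence goes from N_l(F^c) to N_l(F). *)

(* Defs.v *)
From Stdlib Require Import ssreflect ProofIrrelevance.

Set Implicit Arguments.
Unset Strict Implicit.
Unset Printing Implicit Defensive.

(* No category theory library is assumed: homs are plain types with Leibniz
   equality, and proof irrelevance identifies parallel morphisms of
   subcategory-like constructions with the same underlying morphism.
   The prefix nl refers to the left nucleus N_l(G). Composition and tensor
   notations associate to the right; A ◁ f and f ▷ A are the two whiskerings
   written A⊗f and f⊗A when an object also denotes its identity. *)

Declare Scope cat_scope.
Delimit Scope cat_scope with cat.
Local Open Scope cat_scope.

Reserved Notation "g ∘ f" (at level 41, right associativity).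
Reserved Notation "X ⊗ Y" (at level 30, right associativity).
Reserved Notation "f ⊠ g" (at level 30, right associativity).
Reserved Notation "A ◁ f" (at level 30, right associativity).
Reserved Notation "f ▷ A" (at level 30, right associativity).

Record Category := {
  Ob :> Type;
  Hom : Ob -> Ob -> Type;
  idm : forall X, Hom X X;
  comp : forall X Y Z, Hom Y Z -> Hom X Y -> Hom X Z;
  compIm : forall X Y (f : Hom X Y), comp (idm Y) f = f;
  compmI : forall X Y (f : Hom X Y), comp f (idm X) = f;
  compA : forall W X Y Z (h : Hom Y Z) (g : Hom X Y) (f : Hom W X),
    comp (comp h g) f = comp h (comp g f)
}.
Arguments Hom {c} X Y.
Arguments idm {c} X.
Notation "g ∘ f" := (comp g f) : cat_scope.

Record Iso (C : Category) (X Y : C) := {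
  iso_hom :> Hom X Y;
  iso_inv : Hom Y X;
  iso_invK : iso_inv ∘ iso_hom = idm X;
  iso_homK : iso_hom ∘ iso_inv = idm Y
}.

Record Functor (C D : Category) := {
  fob :> C -> D;
  fmap : forall X Y, Hom X Y -> Hom (fob X) (fob Y);
  fmap_id : forall X, fmap (idm X) = idm (fob X);
  fmap_comp : forall X Y Z (g : Hom Y Z) (f : Hom X Y),
    fmap (g ∘ f) = fmap g ∘ fmap f
}.
Arguments fmap {C D} F {X Y} _ : rename.

Record Magmoidal := {
  mag_cat :> Category;
  tob : mag_cat -> mag_cat -> mag_cat;
  tmor : forall X X' Y Y' : mag_cat,
    Hom X X' -> Hom Y Y' -> Hom (tob X Y) (tob X' Y');
  tmor_id : forall X Y, tmor (idm X) (idm Y) = idm (tob X Y);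
  tmor_comp : forall (X X' X'' Y Y' Y'' : mag_cat)
    (f' : Hom X' X'') (f : Hom X X') (g' : Hom Y' Y'') (g : Hom Y Y'),
    tmor (f' ∘ f) (g' ∘ g) = tmor f' g' ∘ tmor f g
}.
Notation "X ⊗ Y" := (tob X Y) : cat_scope.
Notation "f ⊠ g" := (tmor f g) : cat_scope.
Notation "A ◁ f" := (tmor (idm A) f) : cat_scope.
Notation "f ▷ A" := (tmor f (idm A)) : cat_scope.

Record Semigroupal := {
  sg_mag :> Magmoidal;
  assoc : forall X Y Z : sg_mag, Iso (X ⊗ (Y ⊗ Z)) ((X ⊗ Y) ⊗ Z);
  assoc_nat : forall (X X' Y Y' Z Z' : sg_mag)
    (f : Hom X X') (g : Hom Y Y') (h : Hom Z Z'),
    ((f ⊠ g) ⊠ h) ∘ assoc X Y Z = assoc X' Y' Z' ∘ (f ⊠ (g ⊠ h));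
  pentagon : forall X Y Z W : sg_mag,
    assoc (X ⊗ Y) Z W ∘ assoc X Y (Z ⊗ W)
    = (assoc X Y Z ▷ W) ∘ assoc X (Y ⊗ Z) W ∘ (X ◁ assoc Y Z W)
}.

Record QuasiMonoidalStructure (C D : Magmoidal) (F : Functor C D) := {
  qms_iso :> forall X Y : C, Iso (F (X ⊗ Y)) (F X ⊗ F Y);
  qms_nat : forall (X X' Y Y' : C) (f : Hom X X') (g : Hom Y Y'),
    (fmap F f ⊠ fmap F g) ∘ qms_iso X Y = qms_iso X' Y' ∘ fmap F (f ⊠ g)
}.

Record QuasiMonoidalFunctor (C D : Magmoidal) := {
  qm_functor :> Functor C D;
  qm_str : QuasiMonoidalStructure qm_functor
}.
Arguments qm_str {C D} q.

Definition sg_coherent (C D : Semigroupal) (F : QuasiMonoidalFunctor C D) : Prop :=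
  forall X Y Z : C,
    assoc (F X) (F Y) (F Z) ∘ (F X ◁ qm_str F Y Z) ∘ qm_str F X (Y ⊗ Z)
    = (qm_str F X Y ▷ F Z) ∘ qm_str F (X ⊗ Y) Z ∘ fmap F (assoc X Y Z).

Record SemigroupalFunctor (C D : Semigroupal) := {
  sgf_qm :> QuasiMonoidalFunctor C D;
  sgf_coh : sg_coherent sgf_qm
}.

Definition is_identity (C : Category) (X Y : C) (f : Hom X Y) : Prop :=
  exists e : X = Y, f = eq_rect X (fun Z => Hom X Z) (idm X) Y e.

Definition is_strict (C D : Semigroupal) (F : SemigroupalFunctor C D) : Prop :=
  forall X Y : C, is_identity (qm_str F X Y).

Section CategoryLemmas.
Variable C : Category.

Lemma comp_pre (X Y Z W : C) (g : Hom Y Z) (f : Hom X Y) (h : Hom X Z)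
    (k : Hom W X) :
  g ∘ f = h -> g ∘ f ∘ k = h ∘ k.
Proof. by move=> <-; rewrite compA. Qed.

Lemma comp_sq (X Y Y' Z W : C) (g : Hom Y Z) (f : Hom X Y)
    (g' : Hom Y' Z) (f' : Hom X Y') (k : Hom W X) :
  g ∘ f = g' ∘ f' -> g ∘ f ∘ k = g' ∘ f' ∘ k.
Proof. by move=> E; rewrite -!compA E. Qed.

Lemma comp_pre3 (X Y Z Z' W : C) (g : Hom Z Z') (f : Hom Y Z) (e : Hom X Y)
    (h : Hom X Z') (k : Hom W X) :
  g ∘ f ∘ e = h -> g ∘ f ∘ e ∘ k = h ∘ k.
Proof. by move=> <-; rewrite !compA. Qed.

Lemma comp_sq3 (X Y Y' Z Z' T W : C) (g : Hom Z T) (f : Hom Y Z) (e : Hom X Y)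
    (g' : Hom Z' T) (f' : Hom Y' Z') (e' : Hom X Y') (k : Hom W X) :
  g ∘ f ∘ e = g' ∘ f' ∘ e' -> g ∘ f ∘ e ∘ k = g' ∘ f' ∘ e' ∘ k.
Proof. by move=> E; rewrite (comp_pre3 _ E) !compA. Qed.

Lemma iso_epi (X Y Z : C) (i : Iso X Y) (g h : Hom Y Z) :
  g ∘ i = h ∘ i -> g = h.
Proof.
move=> E; rewrite -(compmI g) -(compmI h) -(iso_homK i) -!compA.
by rewrite E.
Qed.

Lemma iso_mono (X Y Z : C) (i : Iso Y Z) (g h : Hom X Y) :
  i ∘ g = i ∘ h -> g = h.
Proof.
move=> E; rewrite -(compIm g) -(compIm h) -(iso_invK i) !compA.
by rewrite E.
Qed.

Lemma iso_invK_pre (X Y W : C) (i : Iso X Y) (k : Hom W X) :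
  iso_inv i ∘ i ∘ k = k.
Proof. by rewrite (comp_pre _ (iso_invK i)) compIm. Qed.

Lemma iso_homK_pre (X Y W : C) (i : Iso X Y) (k : Hom W Y) :
  i ∘ iso_inv i ∘ k = k.
Proof. by rewrite (comp_pre _ (iso_homK i)) compIm. Qed.

Definition id_iso (X : C) : Iso X X :=
  {| iso_hom := idm X; iso_inv := idm X;
     iso_invK := compIm (idm X); iso_homK := compIm (idm X) |}.

Definition inv_iso (X Y : C) (i : Iso X Y) : Iso Y X :=
  {| iso_hom := iso_inv i; iso_inv := i;
     iso_invK := iso_homK i; iso_homK := iso_invK i |}.

Definition comp_iso (X Y Z : C) (j : Iso Y Z) (i : Iso X Y) : Iso X Z.
Proof.
exists (j ∘ i) (iso_inv i ∘ iso_inv j).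
- by rewrite compA iso_invK_pre iso_invK.
- by rewrite compA iso_homK_pre iso_homK.
Defined.

End CategoryLemmas.

Definition fmap_iso (C D : Category) (F : Functor C D) (X Y : C) (i : Iso X Y) :
  Iso (F X) (F Y).
Proof.
exists (fmap F i) (fmap F (iso_inv i)).
- by rewrite -fmap_comp iso_invK fmap_id.
- by rewrite -fmap_comp iso_homK fmap_id.
Defined.

Definition tensor_iso (G : Magmoidal) (X X' Y Y' : G) (i : Iso X X') (j : Iso Y Y') :
  Iso (X ⊗ Y) (X' ⊗ Y').
Proof.
exists (i ⊠ j) (iso_inv i ⊠ iso_inv j).
- by rewrite -tmor_comp !iso_invK tmor_id.
- by rewrite -tmor_comp !iso_homK tmor_id.
Defined.

Section Whiskering.
Variable G : Magmoidal.

Lemma lwhisk_comp (A X Y Z : G) (g : Hom Y Z) (f : Hom X Y) :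
  A ◁ (g ∘ f) = (A ◁ g) ∘ (A ◁ f).
Proof. by rewrite -tmor_comp compIm. Qed.

Lemma rwhisk_comp (A X Y Z : G) (g : Hom Y Z) (f : Hom X Y) :
  (g ∘ f) ▷ A = (g ▷ A) ∘ (f ▷ A).
Proof. by rewrite -tmor_comp compIm. Qed.

Lemma whisk_swap (X X' Y Y' : G) (f : Hom X X') (g : Hom Y Y') :
  (X' ◁ g) ∘ (f ▷ Y) = (f ▷ Y') ∘ (X ◁ g).
Proof. by rewrite -!tmor_comp !compIm !compmI. Qed.

End Whiskering.

Definition id_functor (C : Category) : Functor C C :=
  {| fob := fun X : C => X; fmap := fun X Y (f : Hom X Y) => f;
     fmap_id := fun X => eq_refl; fmap_comp := fun X Y Z g f => eq_refl |}.

Definition comp_functor (C D E : Category) (K : Functor D E) (F : Functor C D) :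
  Functor C E.
Proof.
exists (fun X => K (F X)) (fun X Y f => fmap K (fmap F f)).
- by move=> X; rewrite !fmap_id.
- by move=> X Y Z g f; rewrite !fmap_comp.
Defined.

Definition id_qmfunctor (C : Magmoidal) : QuasiMonoidalFunctor C C.
Proof.
exists (id_functor C); exists (fun X Y : C => id_iso (X ⊗ Y)).
by move=> X X' Y Y' f g /=; rewrite compmI compIm.
Defined.

Definition id_sgfunctor (C : Semigroupal) : SemigroupalFunctor C C.
Proof.
exists (id_qmfunctor C).
by move=> X Y Z /=; rewrite !tmor_id !compmI !compIm.
Defined.

Lemma qms_nat_l (C D : Magmoidal) (F : QuasiMonoidalFunctor C D)
    (X Y Y' : C) (g : Hom Y Y') :
  (F X ◁ fmap F g) ∘ qm_str F X Y = qm_str F X Y' ∘ fmap F (X ◁ g).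
Proof. by rewrite -qms_nat fmap_id. Qed.

Lemma qms_nat_r (C D : Magmoidal) (F : QuasiMonoidalFunctor C D)
    (X X' Y : C) (f : Hom X X') :
  (fmap F f ▷ F Y) ∘ qm_str F X Y = qm_str F X' Y ∘ fmap F (f ▷ Y).
Proof. by rewrite -qms_nat fmap_id. Qed.

Definition comp_qmfunctor (C D E : Magmoidal)
  (K : QuasiMonoidalFunctor D E) (F : QuasiMonoidalFunctor C D) :
  QuasiMonoidalFunctor C E.
Proof.
exists (comp_functor K F).
exists (fun X Y => comp_iso (qm_str K (F X) (F Y)) (fmap_iso K (qm_str F X Y))).
move=> X X' Y Y' f g /=.
rewrite (comp_sq _ (qms_nat (qm_str K) _ _)) compA -!fmap_comp.
by rewrite qms_nat.
Defined.

Lemma comp_sg_coherent (C D E : Semigroupal)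
    (K : SemigroupalFunctor D E) (F : SemigroupalFunctor C D) :
  sg_coherent (comp_qmfunctor K F).
Proof.
move=> X Y Z /=.
rewrite lwhisk_comp rwhisk_comp !compA.
rewrite (comp_sq _ (qms_nat_l _ _ _)) (comp_sq _ (qms_nat_r _ _ _)).
rewrite (comp_pre3 _ (sgf_coh K _ _ _)) !compA -!fmap_comp.
by rewrite (sgf_coh F X Y Z).
Qed.

Definition comp_sgfunctor (C D E : Semigroupal)
  (K : SemigroupalFunctor D E) (F : SemigroupalFunctor C D) :
  SemigroupalFunctor C E :=
  {| sgf_qm := comp_qmfunctor K F; sgf_coh := comp_sg_coherent K F |}.

Record SemigroupalNatIso (C D : Semigroupal) (F K : SemigroupalFunctor C D) := {
  sni_iso :> forall X : C, Iso (F X) (K X);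
  sni_nat : forall (X Y : C) (f : Hom X Y),
    sni_iso Y ∘ fmap F f = fmap K f ∘ sni_iso X;
  sni_tensor : forall X Y : C,
    qm_str K X Y ∘ sni_iso (X ⊗ Y) = (sni_iso X ⊠ sni_iso Y) ∘ qm_str F X Y
}.

(* Equivalence in the 2-category of semigroupal categories: the quasi-inverse
   and both natural isomorphisms are semigroupal. *)
Definition sg_equivalence (C D : Semigroupal) (F : SemigroupalFunctor C D) : Prop :=
  exists K : SemigroupalFunctor D C,
    inhabited (SemigroupalNatIso (comp_sgfunctor K F) (id_sgfunctor C)) /\
    inhabited (SemigroupalNatIso (comp_sgfunctor F K) (id_sgfunctor D)).

Definition tensor_closed (D : Magmoidal) (P : D -> Prop) : Prop :=
  forall X Y : D, P X -> P Y -> P (X ⊗ Y).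

Section FullSubcategory.
Variables (D : Semigroupal) (P : D -> Prop) (clP : tensor_closed P).

Definition full_cat : Category :=
  {| Ob := {X : D | P X};
     Hom := fun X Y => Hom (proj1_sig X) (proj1_sig Y);
     idm := fun X => idm (proj1_sig X);
     comp := fun X Y Z g f => g ∘ f;
     compIm := fun X Y f => compIm f;
     compmI := fun X Y f => compmI f;
     compA := fun W X Y Z h g f => compA h g f |}.

Definition full_iso (X Y : full_cat) (i : Iso (proj1_sig X) (proj1_sig Y)) :
  Iso X Y :=
  {| iso_hom := (iso_hom i : @Hom full_cat X Y);
     iso_inv := (iso_inv i : @Hom full_cat Y X);
     iso_invK := iso_invK i; iso_homK := iso_homK i |}.

Definition full_mag : Magmoidal :=
  {| mag_cat := full_cat;
     tob := fun X Y : full_cat =>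
       exist P (proj1_sig X ⊗ proj1_sig Y) (clP (proj2_sig X) (proj2_sig Y));
     tmor := fun X X' Y Y' f g => f ⊠ g;
     tmor_id := fun X Y => tmor_id (proj1_sig X) (proj1_sig Y);
     tmor_comp := fun X X' X'' Y Y' Y'' f' f g' g => tmor_comp f' f g' g |}.

Definition full_sg : Semigroupal.
Proof.
unshelve refine {| sg_mag := full_mag; assoc := fun X Y Z : full_mag =>
  @full_iso (tob X (tob Y Z)) (tob (tob X Y) Z)
    (assoc (proj1_sig X) (proj1_sig Y) (proj1_sig Z)) |}.
- by move=> X X' Y Y' Z Z' f g h; exact: (@assoc_nat D).
- by move=> X Y Z W; exact: (@pentagon D).
Defined.

End FullSubcategory.

Section Restriction.
Variables (C D : Semigroupal) (T : SemigroupalFunctor C D).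
Variables (P : C -> Prop) (Q : D -> Prop).
Variables (clP : tensor_closed P) (clQ : tensor_closed Q).
Variable st : forall X, P X -> Q (T X).

Definition restrict_functor : Functor (full_sg clP) (full_sg clQ) :=
  {| fob := fun X : full_sg clP =>
       (exist Q (T (proj1_sig X)) (st (proj2_sig X)) : full_sg clQ);
     fmap := fun X Y f => fmap T f;
     fmap_id := fun X => fmap_id T (proj1_sig X);
     fmap_comp := fun X Y Z g f => fmap_comp T g f |}.

Definition restrict_qmfunctor : QuasiMonoidalFunctor (full_sg clP) (full_sg clQ).
Proof.
exists restrict_functor.
exists (fun X Y : full_sg clP =>
  @full_iso D Q (restrict_functor (X ⊗ Y))
    (restrict_functor X ⊗ restrict_functor Y)
    (qm_str T (proj1_sig X) (proj1_sig Y))).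
by move=> X X' Y Y' f g; exact: (qms_nat (qm_str T)).
Defined.

Definition sg_restrict : SemigroupalFunctor (full_sg clP) (full_sg clQ).
Proof.
exists restrict_qmfunctor.
by move=> X Y Z; exact: (sgf_coh T).
Defined.

End Restriction.

Section LeftNucleus.
Variable G : Magmoidal.

Record NlObj := {
  nl_ob :> G;
  nl_iso : forall X Y : G, Iso (nl_ob ⊗ (X ⊗ Y)) ((nl_ob ⊗ X) ⊗ Y);
  nl_nat : forall (X X' Y Y' : G) (f : Hom X X') (g : Hom Y Y'),
    ((nl_ob ◁ f) ⊠ g) ∘ nl_iso X Y = nl_iso X' Y' ∘ (nl_ob ◁ (f ⊠ g))
}.

Record NlHom (A B : NlObj) := {
  nl_hom :> Hom (nl_ob A) (nl_ob B);
  nl_homP : forall X Y : G,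
    ((nl_hom ▷ X) ▷ Y) ∘ nl_iso A X Y = nl_iso B X Y ∘ (nl_hom ▷ (X ⊗ Y))
}.

Lemma nl_hom_eq (A B : NlObj) (f g : NlHom A B) :
  nl_hom f = nl_hom g -> f = g.
Proof.
case: f g => [f pf] [g pg] /= E; case: g / E pg => pg.
by rewrite (proof_irrelevance _ pf pg).
Qed.

Definition nl_id (A : NlObj) : NlHom A A.
Proof.
exists (idm (nl_ob A)); by move=> X Y; rewrite !tmor_id compIm compmI.
Defined.

Definition nl_comp (A B C : NlObj) (g : NlHom B C) (f : NlHom A B) : NlHom A C.
Proof.
exists (nl_hom g ∘ nl_hom f) => X Y.
by rewrite !rwhisk_comp compA nl_homP (comp_sq _ (nl_homP g X Y)).
Defined.

Definition nl_cat : Category.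
Proof.
exists NlObj NlHom nl_id nl_comp.
- by move=> A B f; apply: nl_hom_eq; exact: compIm.
- by move=> A B f; apply: nl_hom_eq; exact: compmI.
- by move=> A B C D h g f; apply: nl_hom_eq; exact: compA.
Defined.

Lemma nl_inv_homP (A B : NlObj) (i : Iso (nl_ob A) (nl_ob B)) :
  (forall X Y : G,
    ((i ▷ X) ▷ Y) ∘ nl_iso A X Y = nl_iso B X Y ∘ (i ▷ (X ⊗ Y))) ->
  forall X Y : G,
    ((iso_inv i ▷ X) ▷ Y) ∘ nl_iso B X Y = nl_iso A X Y ∘ (iso_inv i ▷ (X ⊗ Y)).
Proof.
move=> E X Y; apply: (@iso_epi _ _ _ _ (tensor_iso i (id_iso (X ⊗ Y)))) => /=.
rewrite !compA -E -rwhisk_comp iso_invK tmor_id compmI.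
by rewrite -compA -!rwhisk_comp iso_invK !tmor_id compIm.
Qed.

Definition nl_mk_iso (A B : nl_cat) (i : Iso (nl_ob A) (nl_ob B))
  (iP : forall X Y : G,
    ((i ▷ X) ▷ Y) ∘ nl_iso A X Y = nl_iso B X Y ∘ (i ▷ (X ⊗ Y))) : Iso A B.
Proof.
exists (Build_NlHom iP : Hom A B) (Build_NlHom (nl_inv_homP iP) : Hom B A).
- by apply: nl_hom_eq; exact: iso_invK.
- by apply: nl_hom_eq; exact: iso_homK.
Defined.

(* The component (a|b)_{X,Y}; its defining equation is nl_barE. *)
Definition nl_bar (A B : NlObj) (X Y : G) :
  Iso ((nl_ob A ⊗ nl_ob B) ⊗ (X ⊗ Y)) (((nl_ob A ⊗ nl_ob B) ⊗ X) ⊗ Y) :=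
  comp_iso (tensor_iso (nl_iso A B X) (id_iso Y))
    (comp_iso (nl_iso A (nl_ob B ⊗ X) Y)
      (comp_iso (tensor_iso (id_iso (nl_ob A)) (nl_iso B X Y))
        (inv_iso (nl_iso A B (X ⊗ Y))))).

Lemma nl_barE (A B : NlObj) (X Y : G) :
  nl_bar A B X Y ∘ nl_iso A B (X ⊗ Y)
  = (nl_iso A B X ▷ Y) ∘ nl_iso A (nl_ob B ⊗ X) Y ∘ (nl_ob A ◁ nl_iso B X Y).
Proof. by rewrite /= !compA iso_invK compmI. Qed.

Lemma nl_nat_rr (A : NlObj) (X Y Y' : G) (g : Hom Y Y') :
  ((nl_ob A ⊗ X) ◁ g) ∘ nl_iso A X Y = nl_iso A X Y' ∘ (nl_ob A ◁ (X ◁ g)).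
Proof. by rewrite -nl_nat tmor_id. Qed.

Lemma nl_nat_mid (A : NlObj) (X X' Y : G) (f : Hom X X') :
  ((nl_ob A ◁ f) ▷ Y) ∘ nl_iso A X Y = nl_iso A X' Y ∘ (nl_ob A ◁ (f ▷ Y)).
Proof. exact: nl_nat. Qed.

Lemma nl_bar_nat (A B : NlObj) (X X' Y Y' : G) (f : Hom X X') (g : Hom Y Y') :
  (((nl_ob A ⊗ nl_ob B) ◁ f) ⊠ g) ∘ nl_bar A B X Y
  = nl_bar A B X' Y' ∘ ((nl_ob A ⊗ nl_ob B) ◁ (f ⊠ g)).
Proof.
move: (nl_bar A B) (nl_barE A B) => r rE.
apply: (@iso_epi _ _ _ _ (nl_iso A B (X ⊗ Y))).
rewrite !compA rE nl_nat_rr (comp_sq _ (rE _ _)) !compA.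
rewrite -lwhisk_comp -nl_nat lwhisk_comp.
rewrite -(comp_sq _ (nl_nat _ _ _)) -!compA; congr (_ ∘ _).
by rewrite -!tmor_comp compIm compmI nl_nat_rr.
Qed.

Definition nl_tob (A B : NlObj) : NlObj :=
  {| nl_ob := nl_ob A ⊗ nl_ob B; nl_iso := nl_bar A B; nl_nat := @nl_bar_nat A B |}.

Lemma nl_assoc_nat (A A' : NlObj) (f : NlHom A A')
    (X X' Y Y' : G) (g : Hom X X') (h : Hom Y Y') :
  ((nl_hom f ⊠ g) ⊠ h) ∘ nl_iso A X Y = nl_iso A' X' Y' ∘ (nl_hom f ⊠ (g ⊠ h)).
Proof.
have -> : nl_hom f ⊠ (g ⊠ h) = (nl_ob A' ◁ (g ⊠ h)) ∘ (nl_hom f ▷ (X ⊗ Y)).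
  by rewrite -tmor_comp compIm compmI.
rewrite -(comp_sq _ (nl_nat A' g h)) -nl_homP -!compA; congr (_ ∘ _).
by rewrite -!tmor_comp !compIm !compmI.
Qed.

Lemma nl_tmorP (A A' B B' : NlObj) (f : NlHom A A') (g : NlHom B B') (X Y : G) :
  (((nl_hom f ⊠ nl_hom g) ▷ X) ▷ Y) ∘ nl_iso (nl_tob A B) X Y
  = nl_iso (nl_tob A' B') X Y ∘ ((nl_hom f ⊠ nl_hom g) ▷ (X ⊗ Y)).
Proof.
change (nl_iso (nl_tob A B)) with (nl_bar A B).
change (nl_iso (nl_tob A' B')) with (nl_bar A' B').
move: (nl_bar A B) (nl_barE A B) => r rE.
move: (nl_bar A' B') (nl_barE A' B') => r' rE'.
apply: (@iso_epi _ _ _ _ (nl_iso A B (X ⊗ Y))).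
rewrite !compA rE nl_assoc_nat (comp_sq _ (rE' _ _)) !compA.
rewrite -tmor_comp compIm -nl_homP -{2}(compmI (nl_hom f)) tmor_comp.
rewrite -(comp_sq _ (nl_assoc_nat _ _ _)) -!compA; congr (_ ∘ _); congr (_ ∘ _).
by rewrite -!rwhisk_comp nl_assoc_nat.
Qed.

Definition nl_tmor (A A' B B' : NlObj) (f : NlHom A A') (g : NlHom B B') :
  NlHom (nl_tob A B) (nl_tob A' B') := 
  @Build_NlHom (nl_tob A B) (nl_tob A' B') _ (nl_tmorP f g).

Definition nl_mag : Magmoidal.
Proof.
exists nl_cat nl_tob nl_tmor.
- by move=> A B; apply: nl_hom_eq; exact: tmor_id.
- by move=> A A' A'' B B' B'' f' f g' g; apply: nl_hom_eq; exact: tmor_comp.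
Defined.

Lemma nl_assoc_homP (A B C : NlObj) (X Y : G) :
  ((nl_iso A B C ▷ X) ▷ Y) ∘ nl_iso (nl_tob A (nl_tob B C)) X Y
  = nl_iso (nl_tob (nl_tob A B) C) X Y ∘ (nl_iso A B C ▷ (X ⊗ Y)).
Proof.
have E1 := nl_barE A B; have E2 := nl_barE B C.
have E3 := nl_barE A (nl_tob B C); have E4 := nl_barE (nl_tob A B) C.
change (nl_iso (nl_tob A (nl_tob B C))) with (nl_bar A (nl_tob B C)).
change (nl_iso (nl_tob (nl_tob A B) C)) with (nl_bar (nl_tob A B) C).
change (nl_iso (nl_tob A B)) with (nl_bar A B) in E4.
change (nl_iso (nl_tob B C)) with (nl_bar B C) in E3.
change (nl_ob (nl_tob A B)) with (nl_ob A ⊗ nl_ob B) in E4.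
change (nl_ob (nl_tob B C)) with (nl_ob B ⊗ nl_ob C) in E3.
move: (nl_bar A B) (nl_bar B C) (nl_bar A (nl_tob B C)) (nl_bar (nl_tob A B) C)
  E1 E2 E3 E4 => r1 r2 r3 r4 E1 E2 E3 E4.
apply: (@iso_epi _ _ _ _ (comp_iso (nl_iso A (nl_ob B ⊗ nl_ob C) (X ⊗ Y))
  (tensor_iso (id_iso (nl_ob A)) (nl_iso B C (X ⊗ Y))))) => /=.
rewrite !compA (comp_pre _ (E3 X Y)) -(E1 C (X ⊗ Y)) (comp_pre _ (E4 X Y)) !compA.
rewrite -lwhisk_comp E2 !lwhisk_comp nl_nat_rr (comp_pre _ (E1 _ _)) !compA.
rewrite -(comp_sq _ (nl_nat_mid _ _ _)) -!compA -!rwhisk_comp E1.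
by rewrite -!compA.
Qed.

Definition nl_assoc (A B C : nl_mag) : Iso (A ⊗ (B ⊗ C)) ((A ⊗ B) ⊗ C) :=
  @nl_mk_iso (A ⊗ (B ⊗ C)) ((A ⊗ B) ⊗ C) (nl_iso A B C) (nl_assoc_homP A B C).

Definition nl_sg : Semigroupal.
Proof.
exists nl_mag nl_assoc.
- move=> A A' B B' C C' f g h; apply: nl_hom_eq => /=.
  exact: nl_assoc_nat.
- move=> A B C D; apply: nl_hom_eq; exact: nl_barE.
Defined.

End LeftNucleus.

(* Membership of (A,a) in N_l(F). *)
Definition in_nl (G : Magmoidal) (H : Semigroupal) (F : QuasiMonoidalFunctor G H)
    (A : nl_sg G) : Prop :=
  forall X Y : G,
    assoc (F (nl_ob A)) (F X) (F Y) ∘ (F (nl_ob A) ◁ qm_str F X Y)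
      ∘ qm_str F (nl_ob A) (X ⊗ Y)
    = (qm_str F (nl_ob A) X ▷ F Y) ∘ qm_str F (nl_ob A ⊗ X) Y
      ∘ fmap F (nl_iso A X Y).

Lemma in_nl_closed (G : Magmoidal) (H : Semigroupal)
    (F : QuasiMonoidalFunctor G H) : tensor_closed (in_nl F).
Proof.
move=> A B hA hB X Y.
have E := nl_barE A B.
change (nl_iso (A ⊗ B)) with (nl_bar A B).
change (nl_ob (A ⊗ B)) with (nl_ob A ⊗ nl_ob B).
move: (nl_bar A B) E => r E.
apply: (@iso_epi _ _ _ _ (fmap_iso F (nl_iso A B (X ⊗ Y)))).
apply: (@iso_mono _ _ _ _ (tensor_iso (tensor_iso (qm_str F (nl_ob A) (nl_ob B))
  (id_iso (F X))) (id_iso (F Y)))) => /=.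
rewrite !compA -fmap_comp E !fmap_comp.
rewrite (comp_sq _ (assoc_nat _ _ _)) tmor_id.
rewrite -(comp_sq _ (whisk_swap _ _)) -(hA B (X ⊗ Y)).
rewrite -(tmor_id (F (nl_ob A)) (F (nl_ob B))).
rewrite (comp_sq _ (assoc_nat _ _ _)) (comp_sq _ (pentagon _ _ _ _)) !compA.
have hB' : (F (nl_ob A) ◁ assoc (F (nl_ob B)) (F X) (F Y))
    ∘ (F (nl_ob A) ◁ (F (nl_ob B) ◁ qm_str F X Y))
    ∘ (F (nl_ob A) ◁ qm_str F (nl_ob B) (X ⊗ Y))
  = (F (nl_ob A) ◁ (qm_str F (nl_ob B) X ▷ F Y))
    ∘ (F (nl_ob A) ◁ qm_str F (nl_ob B ⊗ X) Y)
    ∘ (F (nl_ob A) ◁ fmap F (nl_iso B X Y)).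
  by rewrite -!lwhisk_comp hB.
have hA' : (assoc (F (nl_ob A)) (F (nl_ob B)) (F X) ▷ F Y)
    ∘ ((F (nl_ob A) ◁ qm_str F (nl_ob B) X) ▷ F Y)
    ∘ (qm_str F (nl_ob A) (nl_ob B ⊗ X) ▷ F Y)
  = ((qm_str F (nl_ob A) (nl_ob B) ▷ F X) ▷ F Y)
    ∘ (qm_str F (nl_ob A ⊗ nl_ob B) X ▷ F Y)
    ∘ (fmap F (nl_iso A B X) ▷ F Y).
  by rewrite -!rwhisk_comp hA.
rewrite -(comp_sq _ (qms_nat_r _ _ _)) -(comp_sq3 _ hA').
rewrite -(comp_sq3 _ (hA (nl_ob B ⊗ X) Y)) -qms_nat_l.
rewrite (comp_sq _ (assoc_nat _ _ _)).
by rewrite (comp_sq3 _ hB').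
Qed.

Record NatTensorAut (G : Magmoidal) := {
  nta_iso :> forall X Y : G, Iso (X ⊗ Y) (X ⊗ Y);
  nta_nat : forall (X X' Y Y' : G) (f : Hom X X') (g : Hom Y Y'),
    (f ⊠ g) ∘ nta_iso X Y = nta_iso X' Y' ∘ (f ⊠ g)
}.

(* F^c *)
Definition qm_twist (G H : Magmoidal) (F : QuasiMonoidalFunctor G H)
  (c : NatTensorAut G) : QuasiMonoidalFunctor G H.
Proof.
exists F.
exists (fun X Y : G => comp_iso (qm_str F X Y) (fmap_iso F (c X Y))).
move=> X X' Y Y' f g /=.
by rewrite (comp_sq _ (qms_nat _ _ _)) compA -!fmap_comp nta_nat.
Defined.

Section NucleusTwist.
Variables (G : Magmoidal) (c : NatTensorAut G).

(* The component a^c_{X,Y}; its defining equation is nl_twist_isoE. *)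
Definition nl_twist_iso (A : NlObj G) (X Y : G) :
  Iso (nl_ob A ⊗ (X ⊗ Y)) ((nl_ob A ⊗ X) ⊗ Y) :=
  comp_iso (tensor_iso (c (nl_ob A) X) (id_iso Y))
    (comp_iso (c (nl_ob A ⊗ X) Y)
      (comp_iso (nl_iso A X Y)
        (comp_iso (inv_iso (c (nl_ob A) (X ⊗ Y)))
          (inv_iso (tensor_iso (id_iso (nl_ob A)) (c X Y)))))).

Lemma nl_twist_isoE (A : NlObj G) (X Y : G) :
  nl_twist_iso A X Y ∘ (nl_ob A ◁ c X Y) ∘ c (nl_ob A) (X ⊗ Y)
  = (c (nl_ob A) X ▷ Y) ∘ c (nl_ob A ⊗ X) Y ∘ nl_iso A X Y.
Proof.
have E := iso_invK_pre (tensor_iso (id_iso (nl_ob A)) (c X Y)).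
by rewrite /= !compA E iso_invK compmI.
Qed.

(* General form of naturality of a^c; it also covers morphisms (A,a) -> (A',a'). *)
Lemma nl_twist_nat (A A' : NlObj G) (h : NlHom A A')
    (X X' Y Y' : G) (f : Hom X X') (g : Hom Y Y') :
  ((nl_hom h ⊠ f) ⊠ g) ∘ nl_twist_iso A X Y
  = nl_twist_iso A' X' Y' ∘ (nl_hom h ⊠ (f ⊠ g)).
Proof.
move: (nl_twist_iso A) (nl_twist_isoE A) => r rE.
move: (nl_twist_iso A') (nl_twist_isoE A') => r' rE'.
apply: (@iso_epi _ _ _ _ (comp_iso (tensor_iso (id_iso (nl_ob A)) (c X Y))
  (c (nl_ob A) (X ⊗ Y)))) => /=.
rewrite !compA rE.
have -> : (nl_hom h ⊠ (f ⊠ g)) ∘ (nl_ob A ◁ c X Y) ∘ c (nl_ob A) (X ⊗ Y)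
  = (nl_ob A' ◁ c X' Y') ∘ c (nl_ob A') (X' ⊗ Y') ∘ (nl_hom h ⊠ (f ⊠ g)).
  rewrite -nta_nat -!compA; congr (_ ∘ _).
  by rewrite -!tmor_comp compmI compIm nta_nat.
rewrite -!compA.
rewrite !compA (comp_pre3 _ (rE' _ _)) !compA -nl_assoc_nat.
rewrite -(comp_sq _ (nta_nat _ _ _)) -!compA; congr (_ ∘ _); congr (_ ∘ _).
by rewrite -!tmor_comp compIm compmI nta_nat.
Qed.

Definition nl_twist_ob (A : NlObj G) : NlObj G :=
  {| nl_ob := nl_ob A; nl_iso := nl_twist_iso A;
     nl_nat := fun X X' Y Y' f g => @nl_twist_nat A A (nl_id A) X X' Y Y' f g |}.

Lemma nl_twist_homP (A B : NlObj G) (h : NlHom A B) (X Y : G) :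
  ((nl_hom h ▷ X) ▷ Y) ∘ nl_twist_iso A X Y
  = nl_twist_iso B X Y ∘ (nl_hom h ▷ (X ⊗ Y)).
Proof. by rewrite nl_twist_nat tmor_id. Qed.

Definition nl_twist_functor : Functor (nl_sg G) (nl_sg G).
Proof.
exists (nl_twist_ob : nl_sg G -> nl_sg G)
  (fun (A B : nl_sg G) (h : Hom A B) =>
     @Build_NlHom G (nl_twist_ob A) (nl_twist_ob B) (nl_hom h) (nl_twist_homP h)).
- by move=> A; apply: nl_hom_eq.
- by move=> A B C g f; apply: nl_hom_eq.
Defined.

Lemma nl_twist_tensorP (A B : NlObj G) (X Y : G) :
  ((c (nl_ob A) (nl_ob B) ▷ X) ▷ Y) ∘ nl_iso (nl_twist_ob (nl_tob A B)) X Y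
  = nl_iso (nl_tob (nl_twist_ob A) (nl_twist_ob B)) X Y
    ∘ (c (nl_ob A) (nl_ob B) ▷ (X ⊗ Y)).
Proof.
have rE := nl_barE A B.
have sE := nl_twist_isoE (nl_tob A B).
have tE := nl_barE (nl_twist_ob A) (nl_twist_ob B).
have pE := nl_twist_isoE A; have qE := nl_twist_isoE B.
have pN := nl_nat_rr (nl_twist_ob A); have pM := nl_nat_mid (nl_twist_ob A).
change (nl_iso (nl_twist_ob (nl_tob A B))) with (nl_twist_iso (nl_tob A B)).
change (nl_iso (nl_tob (nl_twist_ob A) (nl_twist_ob B)))
  with (nl_bar (nl_twist_ob A) (nl_twist_ob B)).
change (nl_iso (nl_twist_ob A)) with (nl_twist_iso A) in tE, pN, pM.
change (nl_iso (nl_twist_ob B)) with (nl_twist_iso B) in tE.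
change (nl_iso (nl_tob A B)) with (nl_bar A B) in sE.
change (nl_ob (nl_tob A B)) with (nl_ob A ⊗ nl_ob B) in sE.
change (nl_ob (nl_twist_ob A)) with (nl_ob A) in tE, pN, pM.
change (nl_ob (nl_twist_ob B)) with (nl_ob B) in tE.
move: (nl_twist_iso (nl_tob A B)) (nl_bar (nl_twist_ob A) (nl_twist_ob B))
  sE tE => s t sE tE.
move: (nl_bar A B) rE sE => r rE sE.
move: (nl_twist_iso A) (nl_twist_iso B) pE qE tE pN pM => p q pE qE tE pN pM.
apply: (@iso_epi _ _ _ _ (comp_iso
  (tensor_iso (id_iso (nl_ob A ⊗ nl_ob B)) (c X Y))
  (comp_iso (c (nl_ob A ⊗ nl_ob B) (X ⊗ Y)) (nl_iso A B (X ⊗ Y))))) => /=.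
rewrite !compA (comp_pre3 _ (sE X Y)) !compA rE.
rewrite -(comp_sq _ (whisk_swap _ _)) -(pE (nl_ob B) (X ⊗ Y)).
rewrite (comp_sq _ (pN _ _ _ _)) (comp_pre _ (tE X Y)) !compA.
have qE' : (nl_ob A ◁ q X Y) ∘ (nl_ob A ◁ (nl_ob B ◁ c X Y))
    ∘ (nl_ob A ◁ c (nl_ob B) (X ⊗ Y))
  = (nl_ob A ◁ (c (nl_ob B) X ▷ Y)) ∘ (nl_ob A ◁ c (nl_ob B ⊗ X) Y)
    ∘ (nl_ob A ◁ nl_iso B X Y).
  by rewrite -!lwhisk_comp qE.
have pE' : (p (nl_ob B) X ▷ Y) ∘ ((nl_ob A ◁ c (nl_ob B) X) ▷ Y)
    ∘ (c (nl_ob A) (nl_ob B ⊗ X) ▷ Y)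
  = ((c (nl_ob A) (nl_ob B) ▷ X) ▷ Y) ∘ (c (nl_ob A ⊗ nl_ob B) X ▷ Y)
    ∘ (nl_iso A B X ▷ Y).
  by rewrite -!rwhisk_comp pE.
rewrite (comp_sq3 _ qE') nta_nat -(comp_sq _ (pM _ _ _ _)).
rewrite (comp_sq3 _ (pE (nl_ob B ⊗ X) Y)) (comp_sq3 _ pE').
by rewrite -(comp_sq _ (nta_nat c _ _)).
Qed.

(* N_l(c) is the identity on underlying objects and morphisms, but (a|b)^c and
   a^c|b^c agree only up to conjugation by c_{A,B}, and a^c_{B,C} differs from
   a_{B,C}. So the semigroupal constraint of N_l(c) has components c_{A,B}; the
   identities form one only for special c. *)
Definition nl_twist_tensor (A B : nl_sg G) :
  Iso (nl_twist_functor (A ⊗ B)) (nl_twist_functor A ⊗ nl_twist_functor B) :=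
  @nl_mk_iso G (nl_twist_ob (nl_tob A B)) (nl_tob (nl_twist_ob A) (nl_twist_ob B))
    (c (nl_ob A) (nl_ob B)) (nl_twist_tensorP A B).

Definition nl_twist_qm : QuasiMonoidalFunctor (nl_sg G) (nl_sg G).
Proof.
exists nl_twist_functor; exists nl_twist_tensor.
by move=> A A' B B' f g; apply: nl_hom_eq; exact: nta_nat.
Defined.

Definition nl_twist : SemigroupalFunctor (nl_sg G) (nl_sg G).
Proof.
exists nl_twist_qm.
by move=> A B C; apply: nl_hom_eq; exact: nl_twist_isoE.
Defined.

End NucleusTwist.

(* N_l(F) as a semigroupal category. *)
Definition nl_fun (G : Magmoidal) (H : Semigroupal) (F : QuasiMonoidalFunctor G H) :
  Semigroupal := full_sg (@in_nl_closed G H F).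

Definition nl_restrict (G : Magmoidal) (H : Semigroupal)
  (F F' : QuasiMonoidalFunctor G H) (T : SemigroupalFunctor (nl_sg G) (nl_sg G))
  (st : forall A : nl_sg G, in_nl F A -> in_nl F' (T A)) :
  SemigroupalFunctor (nl_fun F) (nl_fun F') :=
  sg_restrict (@in_nl_closed G H F) (@in_nl_closed G H F') st.

(* Main.v *)
(* The square of F applied to a^c becomes, after precomposition with the
   isomorphism F((A◁c) ∘ c) and naturality of the constraint of F, the square of
   F^c applied to a. So (A,a) lies in N_l(F^c) iff (A,a^c) lies in N_l(F). As
   N_l(c) is bijective on homs and (a^{c^-1})^c = a, its restriction is fully
   faithful and surjective on objects up to isomorphism; the quasi-inverse of
   any such semigroupal functor is semigroupal, whatever its constraint. *)
From Stdlib Require Import ssreflect.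
Require Import Defs.

Set Implicit Arguments.
Unset Strict Implicit.
Unset Printing Implicit Defensive.

Local Open Scope cat_scope.

(** * Quasi-inverses of fully faithful, essentially surjective semigroupal functors *)

Section QuasiInverse.
Variables (C D : Semigroupal) (T : SemigroupalFunctor C D).
(** Chosen preimages [k], [e] and [lift] encode essential surjectivity and fullness as data, so the
    quasi-inverse can be constructed explicitly. *)
Variables (k : D -> C) (e : forall Y : D, Iso (T (k Y)) Y).
Variable lift : forall X Y : C, Hom (T X) (T Y) -> Hom X Y.
Hypothesis liftK : forall (X Y : C) (f : Hom (T X) (T Y)), fmap T (lift f) = f.
Hypothesis fmapK : forall (X Y : C) (f : Hom X Y), lift (fmap T f) = f.

Lemma lift_faithful (X Y : C) (f g : Hom X Y) : fmap T f = fmap T g -> f = g.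
Proof. by move=> E; rewrite -(fmapK f) E fmapK. Qed.

Definition lift_iso (X Y : C) (i : Iso (T X) (T Y)) : Iso X Y.
Proof.
exists (lift i) (lift (iso_inv i)); apply: lift_faithful.
- by rewrite fmap_comp !liftK iso_invK fmap_id.
- by rewrite fmap_comp !liftK iso_homK fmap_id.
Defined.

Definition qinv_functor : Functor D C.
Proof.
exists k (fun X Y f => lift (iso_inv (e Y) ∘ f ∘ e X)).
- by move=> X; apply: lift_faithful; rewrite liftK compIm iso_invK fmap_id.
- move=> X Y Z g f; apply: lift_faithful.
  by rewrite fmap_comp !liftK !compA iso_homK_pre.
Defined.

Lemma qinv_fmapE (X Y : D) (f : Hom X Y) :
  e Y ∘ fmap T (fmap qinv_functor f) = f ∘ e X.
Proof. by rewrite /= liftK iso_homK_pre. Qed.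

(** The constraint is forced by asking that [e] be compatible with tensor products; [qinv_tensorE]
    is that condition. *)
Definition qinv_tensor (X Y : D) : Iso (k (X ⊗ Y)) (k X ⊗ k Y) :=
  lift_iso (comp_iso (inv_iso (qm_str T (k X) (k Y)))
    (comp_iso (inv_iso (tensor_iso (e X) (e Y))) (e (X ⊗ Y)))).

Lemma qinv_tensorE (X Y : D) :
  (e X ⊠ e Y) ∘ qm_str T (k X) (k Y) ∘ fmap T (qinv_tensor X Y) = e (X ⊗ Y).
Proof.
rewrite /= liftK iso_homK_pre.
exact: (iso_homK_pre (tensor_iso (e X) (e Y))).
Qed.

(** After applying [T] and composing with an isomorphism, both sides become
    [(f ⊠ g) ∘ e (X ⊗ Y)]. *)
Lemma qinv_tensor_nat (X X' Y Y' : D) (f : Hom X X') (g : Hom Y Y') :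
  (fmap qinv_functor f ⊠ fmap qinv_functor g) ∘ qinv_tensor X Y
  = qinv_tensor X' Y' ∘ fmap qinv_functor (f ⊠ g).
Proof.
apply: lift_faithful.
apply: (@iso_mono _ _ _ _ (comp_iso (tensor_iso (e X') (e Y'))
  (qm_str T (k X') (k Y')))).
rewrite !fmap_comp [iso_hom (comp_iso _ _)]/= !compA.
rewrite (comp_pre3 _ (qinv_tensorE X' Y')) qinv_fmapE.
rewrite -(comp_sq _ (qms_nat (qm_str T) _ _)).
have -> : (e X' ⊠ e Y') ∘ (fmap T (fmap qinv_functor f)
      ⊠ fmap T (fmap qinv_functor g))
    ∘ qm_str T (k X) (k Y) ∘ fmap T (qinv_tensor X Y)
  = (f ⊠ g) ∘ (e X ⊠ e Y) ∘ qm_str T (k X) (k Y) ∘ fmap T (qinv_tensor X Y).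
  by apply: comp_sq; rewrite -!tmor_comp !qinv_fmapE.
by rewrite qinv_tensorE.
Qed.

Definition qinv_qm : QuasiMonoidalFunctor D C :=
  {| qm_functor := qinv_functor;
     qm_str := @Build_QuasiMonoidalStructure _ _ qinv_functor
                 qinv_tensor qinv_tensor_nat |}.

(** Coherence of [T] trades the associator of [C] for that of [D]; naturality of the latter and of
    [e] then reduces both sides to [assoc X Y Z ∘ e (X ⊗ (Y ⊗ Z))]. *)
Lemma qinv_coherent : sg_coherent qinv_qm.
Proof.
move=> X Y Z; apply: lift_faithful.
change (qm_str qinv_qm) with (@Build_QuasiMonoidalStructure _ _ qinv_functor
  qinv_tensor qinv_tensor_nat).
change (fob qinv_qm) with k.
cbn [qms_iso].
apply: (@iso_mono _ _ _ _ (comp_iso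
  (tensor_iso (tensor_iso (e X) (e Y)) (e Z))
  (comp_iso (tensor_iso (qm_str T (k X) (k Y)) (id_iso (T (k Z))))
    (qm_str T (k X ⊗ k Y) (k Z))))).
cbn [iso_hom comp_iso tensor_iso id_iso].
rewrite !fmap_comp !compA.
have L : (e X ⊠ (e Y ⊠ e Z)) ∘ (T (k X) ◁ qm_str T (k Y) (k Z))
    ∘ (T (k X) ◁ fmap T (qinv_tensor Y Z)) = e X ⊠ e (Y ⊗ Z).
  by rewrite -!tmor_comp !compmI qinv_tensorE.
have R : ((e X ⊠ e Y) ⊠ e Z) ∘ (qm_str T (k X) (k Y) ▷ T (k Z))
    ∘ (fmap T (qinv_tensor X Y) ▷ T (k Z)) = e (X ⊗ Y) ⊠ e Z.
  by rewrite -!tmor_comp !compmI qinv_tensorE.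
rewrite -(comp_sq3 _ (sgf_coh T _ _ _)).
rewrite -(comp_sq _ (qms_nat_l T _ _)) -(comp_sq _ (qms_nat_r T _ _)).
rewrite (comp_sq _ (assoc_nat _ _ _)) (comp_pre3 _ L) (comp_pre3 _ R).
rewrite qinv_tensorE (comp_pre3 _ (qinv_tensorE (X ⊗ Y) Z)).
by rewrite (qinv_fmapE (assoc X Y Z)).
Qed.

Definition qinv : SemigroupalFunctor D C :=
  {| sgf_qm := qinv_qm; sgf_coh := qinv_coherent |}.

Definition qinv_counit :
  SemigroupalNatIso (comp_sgfunctor T qinv) (id_sgfunctor D).
Proof.
exists e.
- by move=> X Y f; exact: qinv_fmapE.
- by move=> X Y; rewrite compIm; symmetry; exact: qinv_tensorE.
Defined.

(** The unit at [X] is the morphism that [T] sends to the counit at [T X], so its axioms follow from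
    those of [e] by faithfulness. *)
Definition qinv_unit :
  SemigroupalNatIso (comp_sgfunctor qinv T) (id_sgfunctor C).
Proof.
exists (fun X => lift_iso (e (T X))).
- move=> X Y f; apply: lift_faithful.
  rewrite !fmap_comp; cbn [iso_hom lift_iso]; rewrite !liftK.
  exact: iso_homK_pre.
- move=> X Y; apply: lift_faithful.
  apply: (@iso_mono _ _ _ _ (qm_str T X Y)).
  change (qm_str (id_sgfunctor C) X Y ∘ lift_iso (e (T (X ⊗ Y))))
    with (idm (X ⊗ Y) ∘ lift (e (T (X ⊗ Y)))).
  change (iso_hom (qm_str (comp_sgfunctor qinv T) X Y))
    with (qinv_tensor (T X) (T Y) ∘ fmap qinv_functor (qm_str T X Y)).
  cbn [iso_hom lift_iso].
  rewrite compIm !fmap_comp liftK -(comp_sq _ (qms_nat (qm_str T) _ _))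
    !(liftK (e (T _))).
  rewrite (comp_pre3 _ (qinv_tensorE (T X) (T Y))).
  by rewrite (qinv_fmapE (qm_str T X Y)).
Defined.

Lemma sg_equivalence_fully_faithful : sg_equivalence T.
Proof.
exists qinv; split; constructor; [exact: qinv_unit | exact: qinv_counit].
Qed.

End QuasiInverse.

(** * Inverting the twist, and membership in N_l(F) and N_l(F^c) *)

Section NucleusTwistInverse.
Variables (G : Magmoidal) (c : NatTensorAut G).

Definition nta_inv : NatTensorAut G.
Proof.
exists (fun X Y => inv_iso (c X Y)) => X X' Y Y' f g /=.
apply: (@iso_epi _ _ _ _ (c X Y)); apply: (@iso_mono _ _ _ _ (c X' Y')).
by rewrite !compA iso_invK compmI iso_homK_pre nta_nat.
Defined.

(** Only forward morphisms are compared: they alone enter [nl_homP] and [in_nl], so no equality of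
    records in [NlObj] is required. *)
Lemma nl_twist_invK (A : NlObj G) (X Y : G) :
  iso_hom (nl_iso (nl_twist_ob c (nl_twist_ob nta_inv A)) X Y)
  = iso_hom (nl_iso A X Y).
Proof.
apply: (@iso_epi _ _ _ _ (comp_iso (tensor_iso (id_iso (nl_ob A)) (c X Y))
  (c (nl_ob A) (X ⊗ Y)))) => /=.
rewrite !compA.
have cA := iso_invK_pre (tensor_iso (id_iso (nl_ob A)) (c X Y)).
have cY := iso_homK_pre (tensor_iso (c (nl_ob A) X) (id_iso Y)).
cbn in cA, cY.
rewrite cA iso_invK compmI.
(* Naturality moves [c (nl_ob A ⊗ X) Y] past the inverse of [c (nl_ob A) X ▷ Y], which makes both
   inverse pairs adjacent. *)
rewrite -(comp_sq _ (nta_nat c _ _)) cY iso_homK_pre.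
by rewrite -nta_nat.
Qed.

(** This gives fullness of N_l(c): by naturality [h] slides through every component of [c] in the
    defining equation of a^c. *)
Lemma nl_twist_homP_inv (A B : NlObj G) (h : Hom (nl_ob A) (nl_ob B)) :
  (forall X Y : G, ((h ▷ X) ▷ Y) ∘ nl_twist_iso c A X Y
    = nl_twist_iso c B X Y ∘ (h ▷ (X ⊗ Y))) ->
  forall X Y : G,
    ((h ▷ X) ▷ Y) ∘ nl_iso A X Y = nl_iso B X Y ∘ (h ▷ (X ⊗ Y)).
Proof.
move=> hP X Y.
apply: (@iso_mono _ _ _ _ (comp_iso (tensor_iso (c (nl_ob B) X) (id_iso Y))
  (c (nl_ob B ⊗ X) Y))) => /=.
rewrite !compA -(comp_sq3 _ (nl_twist_isoE c B X Y)).
rewrite -(comp_sq _ (nta_nat c (h ▷ X) (idm Y))).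
have -> : (c (nl_ob B) X ▷ Y) ∘ ((h ▷ X) ▷ Y) ∘ c (nl_ob A ⊗ X) Y ∘ nl_iso A X Y
  = ((h ▷ X) ▷ Y) ∘ (c (nl_ob A) X ▷ Y) ∘ c (nl_ob A ⊗ X) Y ∘ nl_iso A X Y.
  by apply: comp_sq; rewrite -!rwhisk_comp nta_nat.
rewrite -nl_twist_isoE (comp_sq _ (hP X Y)).
by rewrite -(comp_sq _ (whisk_swap _ _)) -tmor_id nta_nat.
Qed.

Variables (H : Semigroupal) (F : QuasiMonoidalFunctor G H).

Lemma in_nl_twist (A : nl_sg G) :
  in_nl (qm_twist F c) A <-> in_nl F (nl_twist c A).
Proof.
have E X Y : assoc (F (nl_ob A)) (F X) (F Y)
      ∘ (F (nl_ob A) ◁ qm_str (qm_twist F c) X Y)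
      ∘ qm_str (qm_twist F c) (nl_ob A) (X ⊗ Y)
    = (assoc (F (nl_ob A)) (F X) (F Y) ∘ (F (nl_ob A) ◁ qm_str F X Y)
      ∘ qm_str F (nl_ob A) (X ⊗ Y))
      ∘ fmap F ((nl_ob A ◁ c X Y) ∘ c (nl_ob A) (X ⊗ Y)).
  rewrite /= lwhisk_comp !compA (comp_sq _ (qms_nat_l _ _ _)).
  by rewrite fmap_comp.
have E' X Y : (qm_str (qm_twist F c) (nl_ob A) X ▷ F Y)
      ∘ qm_str (qm_twist F c) (nl_ob A ⊗ X) Y ∘ fmap F (nl_iso A X Y)
    = ((qm_str F (nl_ob A) X ▷ F Y) ∘ qm_str F (nl_ob A ⊗ X) Y
      ∘ fmap F (nl_twist_iso c A X Y))
      ∘ fmap F ((nl_ob A ◁ c X Y) ∘ c (nl_ob A) (X ⊗ Y)).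
  rewrite !compA -fmap_comp nl_twist_isoE !fmap_comp.
  by rewrite /= rwhisk_comp !compA (comp_sq _ (qms_nat_r _ _ _)).
split=> hA X Y.
- apply: (@iso_epi _ _ _ _ (fmap_iso F (comp_iso
    (tensor_iso (id_iso (nl_ob A)) (c X Y)) (c (nl_ob A) (X ⊗ Y))))).
  exact: (eq_trans (eq_sym (E X Y)) (eq_trans (hA X Y) (E' X Y))).
- refine (eq_trans (E X Y) (eq_trans _ (eq_sym (E' X Y)))).
  by congr (_ ∘ _); exact: hA.
Qed.

Lemma in_nl_twist_inv (A : nl_sg G) :
  in_nl F A -> in_nl (qm_twist F c) (nl_twist_ob nta_inv A).
Proof.
move=> hA; apply/in_nl_twist => X Y.
by rewrite [iso_hom (nl_iso _ _ _)]nl_twist_invK; exact: hA.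
Qed.

(** The constraint [s] is arbitrary because [k], [e] and [lift] are built from the underlying
    functor only; one argument thus covers both components [c] and identities. *)
Lemma nl_restrict_twist_equivalence
    (s : QuasiMonoidalStructure (nl_twist_functor c))
    (hs : sg_coherent (C := nl_sg G) (D := nl_sg G)
            {| qm_functor := nl_twist_functor c; qm_str := s |})
    (st : forall A : nl_sg G, in_nl (qm_twist F c) A -> in_nl F (nl_twist c A)) :
  sg_equivalence (@nl_restrict G H (qm_twist F c) F
    {| sgf_qm := {| qm_functor := nl_twist_functor c; qm_str := s |};
       sgf_coh := hs |} st).
Proof.
set T := nl_restrict _.
pose k (A : nl_fun F) : nl_fun (qm_twist F c) :=
  exist (in_nl (qm_twist F c)) (nl_twist_ob nta_inv (proj1_sig A))
    (in_nl_twist_inv (proj2_sig A)).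
have eP (A : nl_sg G) (X Y : G) :
    ((id_iso (nl_ob A) ▷ X) ▷ Y)
      ∘ nl_iso (nl_twist_ob c (nl_twist_ob nta_inv A)) X Y
    = nl_iso A X Y ∘ (id_iso (nl_ob A) ▷ (X ⊗ Y)).
  rewrite [iso_hom (nl_iso (nl_twist_ob _ _) _ _)]nl_twist_invK.
  by rewrite !tmor_id compIm compmI.
(* The two objects share their underlying object of [G], so the identity there serves as the
   isomorphism. *)
pose e (A : nl_fun F) : Iso (T (k A)) A :=
  @full_iso (nl_sg G) (in_nl F) (T (k A)) A
    (@nl_mk_iso G (nl_twist_ob c (nl_twist_ob nta_inv (proj1_sig A)))
      (proj1_sig A) _ (eP (proj1_sig A))).
(* Lifting keeps the underlying morphism, so both round trips hold by [nl_hom_eq]. *)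
pose lift (A B : nl_fun (qm_twist F c)) (f : Hom (T A) (T B)) : Hom A B :=
  @Build_NlHom G (proj1_sig A) (proj1_sig B) (nl_hom f)
    (@nl_twist_homP_inv (proj1_sig A) (proj1_sig B) (nl_hom f) (nl_homP f)).
apply: (@sg_equivalence_fully_faithful _ _ T k e lift) => A B f;
  exact: nl_hom_eq.
Qed.

End NucleusTwistInverse.

(* N_l(c) restricts to an equivalence from N_l(F^c) to N_l(F). The second clause covers the case where
   the identities are a semigroupal structure on N_l(c). *)
Theorem proposition2p4p2 (G : Magmoidal) (H : Semigroupal)
    (F : QuasiMonoidalFunctor G H) (c : NatTensorAut G) :
  exists st : forall A : nl_sg G, in_nl (qm_twist F c) A -> in_nl F (nl_twist c A),
    sg_equivalence (@nl_restrict G H (qm_twist F c) F (nl_twist c) st) /\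
    forall (s : QuasiMonoidalStructure (nl_twist_functor c))
      (hs : sg_coherent (C := nl_sg G) (D := nl_sg G)
              {| qm_functor := nl_twist_functor c; qm_str := s |}),
      let T : SemigroupalFunctor (nl_sg G) (nl_sg G) :=
        {| sgf_qm := {| qm_functor := nl_twist_functor c; qm_str := s |};
           sgf_coh := hs |} in
      is_strict T ->
      sg_equivalence (@nl_restrict G H (qm_twist F c) F T st).
Proof.
exists (fun A => proj1 (@in_nl_twist G c H F A)); split.
- exact: nl_restrict_twist_equivalence.
- by move=> s hs T _; exact: nl_restrict_twist_equivalence.
Qed.
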